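(* Let $G_{\bar n}$ be an arbitrary Dynkin diagram on the vertex set $\bar n=\{1,\dots,n\}$ with edge weights $a_{ij}=a_{ji}$. Then $$\mathrm{Bez}(G_{\bar n}(q),G_{\bar n\setminus 1}(q))=(1-(xy)^{-1})\,G_{\bar n\setminus 1}(x)G_{\bar n\setminus 1}(y)+\sum_{2\le i\le n}a_{1i}^2\,\mathrm{Bez}(G_{\bar n\setminus 1}(q),G_{\bar n\setminus\{1,i\}}(q))+\sum_{2\le i\ne j\le n}a_{1i}a_{1j}\,\mathrm{Bez}(G_{\bar n\setminus 1}(q),P_{ij}(q)),$$ $$\mathrm{Wr}(G_{\bar n}(q),G_{\bar n\setminus 1}(q))=(1-x^{-2})\,G_{\bar n\setminus 1}^2(x)+\sum_{2\le i\le n}a_{1i}^2\,\mathrm{Wr}(G_{\bar n\setminus 1}(q),G_{\bar n\setminus\{1,i\}}(q))+\sum_{2\le i\ne j\le n}a_{1i}a_{1j}\,\mathrm{Wr}(G_{\bar n\setminus 1}(q),P_{ij}(q)).$$ In particular, if $T_{\bar n}$ is the join of Dynkin diagrams $T_i$ with marked vertices $v_i$, and $\bar T_i$ denotes the diagram obtained from $T_i$ by deleting $v_i$, then $$\mathrm{Bez}\Big(T_{\bar n}(q),\prod_i T_i(q)\Big)=(1-(xy)^{-1})\prod_i T_i(x)T_i(y)+\sum_j\mathrm{Bez}(T_j(q),\bar T_j(q)),$$ $$\mathrm{Wr}\Big(T_{\bar n}(q),\prod_i T_i(q)\Big)=(1-x^{-2})\prod_i T_i^2(x)+\sum_j\mathrm{Wr}(T_j(q),\bar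 T_j(q)).$$
   Context: A Dynkin diagram $G_{\bar n}$ is a finite graph without loops or multiple edges on the vertex set $\bar n=\{1,\dots,n\}$, with weights (numbers) $a_{ij}=a_{ji}$, $i\neq j$, where $a_{ij}=0$ means that there is no edge $ij$. Let $S$ be the upper triangular $n\times n$ matrix with ones on the diagonal and entries $-a_{ij}$ above the diagonal ($i<j$). The (symmetrized) Coxeter polynomial is the Laurent polynomial $$G_{\bar n}(q)=\det(qS+q^{-1}S^t).$$ For a subset $I\subset\bar n$, $G_{\bar n\setminus I}$ is the diagram obtained by deleting the vertices in $I$ (with the induced order on the remaining vertices), and $G_{\bar n\setminus I}(q)$ is its Coxeter polynomial; $G_{\bar n\setminus 1}=G_{\bar n\setminus\{1\}}$. The Coxeter polynomial of the empty diagram is $1$. For $2\le i\ne j\le n$, $P_{ij}(q)$ denotes the algebraic complement (cofactor) of the entry $-a_{ij}$ in the position $(i,j)$ (rows and columns keep their original indices $2,\dots,n$) in the matrix obtained from $qS+q^{-1}S^t$ by deleting the first row and the first column. One has $P_{ij}(q)=P_{ji}(q^{-1})$. The sum over $2\le i\neq j\le n$ is over ordered pairs. For functions $f,g$ of one variable (here, of $q$), the Bezoutian and the Wronskian are $$\mathrm{Bez}(f,g)=\frac{f(x)g(y)-f(y)g(x)}{x-y},\qquad \mathrm{Wr}(f,g)=\lim_{y\to x}\mathrm{Bez}(f,g)=f'(x)g(x)-f(x)g'(x).$$ Join: given finitely many Dynkin diagrams $T_i$, each with a marked vertex $v_i$, their join $T_{\bar n}$ is the Dynkin diagram obtained by adding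 to the disjoint union of the $T_i$ one further vertex $v$ and edges of weight $1$ connecting $v$ with every $v_i$. Vertices of $T_{\bar n}$ are numbered so that the order restricts to the given order on each $T_i$.
   Formalization: The join formulas are false as printed for two or more T_i (e.g. two single vertices, T = A_3); here Bez(T_j, T̄_j) is multiplied by the product over i≠j of T_i(x)T_i(y), and Wr(T_j, T̄_j) by the product over i≠j of T_i(x)^2. *)

(* Defs.v *)
From HB Require Import structures.
From mathcomp Require Import all_boot all_order all_algebra.
From mathcomp Require Import boolp classical_sets functions reals topology.
From mathcomp Require Import normedtype derive.

Set Implicit Arguments.
Unset Strict Implicit.
Unset Printing Implicit Defensive.

Import Order.TTheory GRing.Theory Num.Theory.
Import numFieldNormedType.Exports.

Local Open Scope ring_scope.
Local Open Scope classical_set_scope.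

(* Vertices are 'I_n, i.e. 0, ..., n-1 instead of 1, ..., n. *)
Record dynkin (K : numFieldType) (n : nat) := Dynkin {
  weight :> 'I_n -> 'I_n -> K;
  weight_sym : forall i j, weight i j = weight j i;
  weight_loop : forall i, weight i i = 0 }.

Section Coxeter.
Variables (K : numFieldType) (n : nat) (G : dynkin K n).

Definition seifert : 'M[K]_n :=
  \matrix_(i, j) if i == j then 1 else if (i < j)%N then - G i j else 0.

Definition coxmx (q : K) : 'M[K]_n := q *: seifert + q^-1 *: seifert^T.

(* Only the values at q != 0 are meaningful. *)
Definition coxpoly (q : K) : K := \det (coxmx q).

Section Delete.
Variable I : {set 'I_n}.

Definition delete_weight (i j : 'I_#|~: I|) : K :=
  G (enum_val i) (enum_val j).

Fact delete_sym i j : delete_weight i j = delete_weight j i.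
Proof. exact: weight_sym. Qed.

Fact delete_loop i : delete_weight i i = 0.
Proof. exact: weight_loop. Qed.

(* [enum_val] lists the remaining vertices in increasing order. *)
Definition delete : dynkin K #|~: I| := Dynkin delete_sym delete_loop.
End Delete.
End Coxeter.

(* For i, j : 'I_n the corresponding vertices of G are [lift ord0 i] and
   [lift ord0 j]; the common shift of both indices does not affect the sign
   of the cofactor. *)
Definition coxcof (K : numFieldType) (n : nat) (G : dynkin K n.+1)
    (i j : 'I_n) (q : K) : K :=
  cofactor (row' ord0 (col' ord0 (coxmx G q))) i j.

(* To be used at x != y only (division by zero yields zero). *)
Definition Bez (K : numFieldType) (f g : K -> K) (x y : K) : K :=
  (f x * g y - f y * g x) / (x - y).

(* The limit exists and has the usual expression as soon as f and g are
   derivable at x, see [cvg_Bez] and [WrE]; by [derivable_coxpoly] and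
   [derivable_coxcof] this covers all the functions of interest. *)
Definition Wr (K : numFieldType) (f g : K -> K) (x : K) : K :=
  lim (Bez f g x y @[y --> x^']).

(* G is the join of the diagrams T i with marked vertices v i: c is the added
   vertex and e i embeds T i into G, compatibly with the orders.  The position
   of c and the way the different T i interleave are arbitrary. *)
Definition is_join (K : numFieldType) (I : finType) (m : I -> nat)
    (T : forall i, dynkin K (m i)) (v : forall i, 'I_(m i))
    (n : nat) (G : dynkin K n) : Prop :=
  exists (c : 'I_n) (e : forall i, 'I_(m i) -> 'I_n),
    [/\ forall i (a b : 'I_(m i)), (a < b)%N -> (e i a < e i b)%N,
        forall i j a b, e i a = e j b -> i = j,
        forall i a, e i a <> c &
        forall u, u = c \/ exists i a, u = e i a] /\
    [/\ forall i a b, G (e i a) (e i b) = T i a b,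
        forall i j a b, i <> j -> G (e i a) (e j b) = 0 &
        forall i a, G c (e i a) = (a == v i)%:R].

Section Wronskian.
Variable K : numFieldType.
Implicit Types f g : K -> K.

Fact cvg_subr_dnbhs (x : K) : y - x @[y --> x^'] --> (0 : K)^'.
Proof.
move=> A; rewrite /dnbhs /= /within /= => HA.
have /(_ _ HA) : (y - x) @[y --> x] --> (0 : K).
  rewrite -(subrr x).
  by apply: continuousB => //; exact: cst_continuous.
rewrite /nbhs /=; apply: (@filterS _ (nbhs x) _) => y /= Hy nyx.
by apply: Hy; rewrite subr_eq0.
Qed.

Lemma cvg_slope f (x : K) : derivable f x 1 ->
  (f x - f y) / (x - y) @[y --> x^'] --> derive1 f x.
Proof.
move=> df; rewrite derive1E.
have := cvg_comp _ _ (@cvg_subr_dnbhs x) df; apply: cvg_trans; apply: near_eq_cvg.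
near=> y => /=.
rewrite /GRing.scale /= mulr1 subrK -[x - y]opprB invrN mulrN -mulNr opprB.
by rewrite mulrC.
Unshelve. all: by end_near. Qed.

Lemma cvg_Bez f g (x : K) : derivable f x 1 -> derivable g x 1 ->
  Bez f g x y @[y --> x^'] --> derive1 f x * g x - f x * derive1 g x.
Proof.
move=> /cvg_slope sf /cvg_slope sg.
have -> : Bez f g x = fun y =>
    (f x - f y) / (x - y) * g x - f x * ((g x - g y) / (x - y)).
  apply/funext => y; rewrite /Bez mulrA mulrAC -mulrBl; congr (_ / _).
  by rewrite mulrBl mulrBr opprB [RHS]addrC addrA subrK.
apply: (@cvgB K K K x^' _); apply: (@cvgM K K x^' _) => //; exact: cvg_cst.
Qed.

Lemma WrE f g (x : K) : derivable f x 1 -> derivable g x 1 ->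
  Wr f g x = derive1 f x * g x - f x * derive1 g x.
Proof. by move=> df dg; apply: cvg_lim => //; exact: cvg_Bez. Qed.

Lemma derivable_bigprod (J : Type) (r : seq J) (P : pred J) (h : J -> K -> K)
    (x : K) : (forall j, derivable (h j) x 1) ->
  derivable (fun q => \prod_(j <- r | P j) h j q) x 1.
Proof.
move=> dh; elim: r => [|j r IH].
  by under eq_fun do rewrite big_nil; exact: derivable_cst.
under eq_fun do rewrite big_cons.
by case: (P j); [exact: (derivableM (dh j) IH)|exact: IH].
Qed.

Lemma derivable_bigsum (J : Type) (r : seq J) (P : pred J) (h : J -> K -> K)
    (x : K) : (forall j, derivable (h j) x 1) ->
  derivable (fun q => \sum_(j <- r | P j) h j q) x 1.
Proof.
move=> dh; elim: r => [|j r IH].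
  by under eq_fun do rewrite big_nil; exact: derivable_cst.
under eq_fun do rewrite big_cons.
by case: (P j); [exact: (derivableD (dh j) IH)|exact: IH].
Qed.

Lemma derivable_det n (M : K -> 'M[K]_n) (x : K) :
  (forall i j, derivable (fun q => M q i j) x 1) ->
  derivable (fun q => \det (M q)) x 1.
Proof.
move=> dM; apply: derivable_bigsum => s; apply: derivableM.
  exact: derivable_cst.
by apply: derivable_bigprod => i; exact: dM.
Qed.

Lemma derivable_coxmx n (G : dynkin K n) i j (x : K) : x != 0 ->
  derivable (fun q => coxmx G q i j) x 1.
Proof.
move=> x0; under eq_fun do rewrite /coxmx 4!mxE.
apply: derivableD; apply: derivableM; [exact: derivable_id| | |].
- exact: derivable_cst.
- by apply: derivableV; [exact: x0|exact: derivable_id].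
- exact: derivable_cst.
Qed.

Lemma derivable_coxpoly n (G : dynkin K n) (x : K) : x != 0 ->
  derivable (coxpoly G) x 1.
Proof.
by move=> x0; apply: derivable_det => i j; exact: derivable_coxmx.
Qed.

Lemma derivable_coxcof n (G : dynkin K n.+1) i j (x : K) : x != 0 ->
  derivable (coxcof G i j) x 1.
Proof.
move=> x0; apply: derivableM; first exact: derivable_cst.
apply: derivable_det => k l; under eq_fun do rewrite 4!mxE.
exact: derivable_coxmx.
Qed.

End Wronskian.

(* Main.v *)
Require Import Defs.
From mathcomp Require Import all_boot all_order all_algebra all_fingroup.

Set Implicit Arguments.
Unset Strict Implicit.
Unset Printing Implicit Defensive.

Import Order.TTheory GRing.Theory Num.Theory.
Local Open Scope ring_scope.

(** The matrix [coxmx G q] has [q + q^-1] on the diagonal, and its entries at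
    [(i, j)] and [(j, i)] are [- G i j * q] and [- G i j * q^-1] in some order,
    so that their product [G i j ^+ 2] does not depend on [q].  Expanding the
    determinant along the row and the column of a vertex [c] ([det_border])
    therefore gives
      [coxpoly G q = (q + q^-1) * g q - \sum_j h j q]
    where [g] is the Coxeter polynomial of the diagram without [c], and the
    [h j] are products of weights and cofactors ([coxpoly_vertex]).  The
    Bezoutian is linear in its first argument, antisymmetric, and
    [Bez ((q + q^-1) * g) g] is [(1 - (x * y)^-1) * (g x * g y)]; this is the
    formula for [Bez] ([Bez_recurrence]).  Letting [y] tend to [x] turns it
    into the formula for [Wr] ([Wr_recurrence]).

    For a join, the matrix without the added vertex is block diagonal up to a
    renumbering, and each [h j] becomes the Coxeter polynomial of one
    [T j] without its marked vertex times those of the other [T k]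
    ([coxpoly_join]).  The common factor can be taken out of the Bezoutian of
    [g] and [h j] ([Bez_mulr]), and the same recurrence applies.  The added
    vertex may come at any place in the order: only the product of the two
    entries joining it to a marked vertex enters, and it is always 1. *)

(** * Principal minors and bordered determinants *)

Section Determinants.
Variable R : comPzRingType.

(** Two injective enumerations of the same index set differ by a permutation,
    which acts on rows and columns at once; the two signs cancel. *)
Lemma det_mxsub_codom m m' n (f : 'I_m -> 'I_n) (g : 'I_m' -> 'I_n)
    (M : 'M[R]_n) : injective f -> injective g -> codom f =i codom g ->
  \det (mxsub f f M) = \det (mxsub g g M).
Proof.
move=> f_inj g_inj fg.
have em : m = m'.
  by rewrite -(card_ord m) -(card_ord m') -(card_codom f_inj)
             -(card_codom g_inj); apply: eq_card.
subst m'.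
have gf a : f a \in codom g by rewrite -fg codom_f.
pose s a := iinv (gf a).
have gs a : g (s a) = f a by rewrite f_iinv.
have s_inj : injective s by move=> a b sab; apply: f_inj; rewrite -!gs sab.
have -> : mxsub f f M =
    row_perm (perm s_inj) (col_perm (perm s_inj) (mxsub g g M)).
  by apply/matrixP => a b; rewrite !mxE !permE !gs.
rewrite row_permE col_permE !det_mulmx !det_perm odd_permV mulrCA -signr_addb.
by rewrite addbb mulr1.
Qed.

Definition minor n (M : 'M[R]_n) (A : {set 'I_n}) : R :=
  \det (mxsub (@enum_val _ (mem A)) (@enum_val _ (mem A)) M).

Lemma det_mxsub_minor m n (f : 'I_m -> 'I_n) (M : 'M[R]_n) (A : {set 'I_n}) :
  injective f -> codom f =i A -> \det (mxsub f f M) = minor M A.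
Proof.
move=> f_inj fA; apply: det_mxsub_codom => //; first exact: enum_val_inj.
move=> u; rewrite fA; apply/idP/codomP => [uA | [k ->]].
  by exists (enum_rank_in uA u); rewrite enum_rankK_in.
exact: enum_valP.
Qed.

Lemma eq_minor n (M M' : 'M[R]_n) (A : {set 'I_n}) :
  {in A &, forall a b, M a b = M' a b} -> minor M A = minor M' A.
Proof.
move=> MM'; congr (\det _); apply/matrixP => a b.
by rewrite !mxE MM' ?enum_valP.
Qed.

Lemma minor0 n (M : 'M[R]_n) : minor M set0 = 1.
Proof.
by rewrite /minor; move: enum_val; rewrite cards0 => f; rewrite det_mx00.
Qed.

(** Listing [A] before [B] makes the submatrix block triangular. *)
Lemma minorU n (M : 'M[R]_n) (A B : {set 'I_n}) : [disjoint A & B] ->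
  {in B & A, forall b a, M b a = 0} ->
  minor M (A :|: B) = minor M A * minor M B.
Proof.
move=> dAB MBA.
pose h (k : 'I_(#|A| + #|B|)) : 'I_n :=
  match split k with inl a => enum_val a | inr b => enum_val b end.
have hl a : h (lshift _ a) = enum_val a by rewrite /h (unsplitK (inl a)).
have hr b : h (rshift _ b) = enum_val b by rewrite /h (unsplitK (inr b)).
have neq (a : 'I_#|A|) (b : 'I_#|B|) : enum_val a <> enum_val b.
  by move=> e; have := enum_valP b; rewrite -e (disjointFr dAB) ?enum_valP.
have h_inj : injective h.
  move=> k l; case: (split_ordP k) => a ->; case: (split_ordP l) => b ->;
    rewrite ?hl ?hr => e.
  - by rewrite (enum_val_inj e).
  - by case: (neq a b).
  - by case: (neq b a).
  - by rewrite (enum_val_inj e).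
have hAB : codom h =i A :|: B.
  move=> u; apply/codomP/setUP => [[k ->]|].
    by case: (split_ordP k) => a ->; rewrite ?hl ?hr enum_valP; [left|right].
  case=> uX.
    by exists (lshift _ (enum_rank_in uX u)); rewrite hl enum_rankK_in.
  by exists (rshift _ (enum_rank_in uX u)); rewrite hr enum_rankK_in.
rewrite -(det_mxsub_minor _ h_inj hAB) -[mxsub h h M]submxK.
have -> : dlsubmx (mxsub h h M) = 0.
  by apply/matrixP => b a; rewrite !mxE hl hr MBA ?enum_valP.
have -> : ulsubmx (mxsub h h M) = mxsub enum_val enum_val M.
  by apply/matrixP => a b; rewrite !mxE !hl.
have -> : drsubmx (mxsub h h M) = mxsub enum_val enum_val M.
  by apply/matrixP => a b; rewrite !mxE !hr.
by rewrite det_ublock.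
Qed.

Lemma minor_bigcup n (M : 'M[R]_n) (I : finType) (A : I -> {set 'I_n})
    (P : pred I) :
  (forall i j, i != j -> [disjoint A i & A j]) ->
  (forall i j a b, i != j -> a \in A i -> b \in A j -> M a b = 0) ->
  minor M (\bigcup_(i | P i) A i) = \prod_(i | P i) minor M (A i).
Proof.
move=> dA MA; have [k] := ubnP #|P|; elim: k P => // k IH P.
case: (pickP P) => [i Pi|P0 _]; last by rewrite !big_pred0 ?minor0.
rewrite (cardD1 i) [i \in P]Pi ltnS => leP.
rewrite !(bigD1 i Pi) /= minorU.
- congr (_ * _); rewrite IH //; apply: leq_trans leP.
  by rewrite ltnS; apply: eq_leq; apply: eq_card => j; rewrite !inE andbC.
- by apply: bigcup_disjoint => j /andP[_ ji]; apply: dA; rewrite eq_sym.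
- by move=> b a /bigcupP[j /andP[_ ji] bj] ai; apply: MA bj ai.
Qed.

Lemma cofactor_diag n (M : 'M[R]_n) (c : 'I_n) :
  cofactor M c c = \det (mxsub (lift c) (lift c) M).
Proof.
rewrite /cofactor addnn -signr_odd odd_double mul1r; congr (\det _).
by apply/matrixP => a b; rewrite !mxE.
Qed.

Definition replace_row n (M : 'M[R]_n) (u c : 'I_n) : 'M[R]_n :=
  \matrix_(a, b) if a == u then M c b else M a b.

(** After the replacement the rows [u] and [c] agree outside column [c].  The
    witness [Y] has ones in column [c] at these two rows, so they are equal and
    [\det Y = 0]; its expansion along column [c] is the sum of the two
    cofactors. *)
Lemma cofactor_replace_row n (M : 'M[R]_n) (c u : 'I_n) : u != c ->
  cofactor M u c = - cofactor (replace_row M u c) c c.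
Proof.
move=> uc.
pose Y : 'M[R]_n := \matrix_(a, b)
  if b == c then ((a == c) || (a == u))%:R else replace_row M u c a b.
have Y0 : \det Y = 0.
  apply: (determinant_alternate (i1 := u) (i2 := c)) => // b.
  by rewrite !mxE !eqxx orbT /= [c == u]eq_sym (negPf uc).
have -> : cofactor (replace_row M u c) c c = cofactor Y c c.
  congr (_ * \det _); apply/matrixP => a b; rewrite !mxE.
  by rewrite [lift c b == c]eq_sym (negPf (neq_lift _ _)).
have -> : cofactor M u c = cofactor Y u c.
  congr (_ * \det _); apply/matrixP => a b; rewrite !mxE.
  by rewrite [lift c b == c]eq_sym (negPf (neq_lift _ _)) [lift u a == u]eq_sym
             (negPf (neq_lift _ _)).
apply/eqP; rewrite -addr_eq0 addrC -Y0 (expand_det_col Y c) (bigD1 c) //=.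
rewrite (bigD1 u) //= big1 => [|a /andP[ac au]].
  by rewrite !mxE !eqxx orbT !mul1r addr0.
by rewrite !mxE eqxx (negPf ac) (negPf au) mul0r.
Qed.

(** The cofactor of an entry [(u, c)] of the column of [c] still contains the row
    of [c]; exchanging it with row [u] gives a determinant over the complement
    of [c], with row [u] replaced by row [c]. *)
Lemma det_border n (M : 'M[R]_n) (c : 'I_n) :
  \det M = M c c * cofactor M c c
           - \sum_(u | u != c) M u c * cofactor (replace_row M u c) c c.
Proof.
rewrite (expand_det_col M c) (bigD1 c) //= -sumrN; congr (_ + _).
by apply: eq_bigr => u uc; rewrite cofactor_replace_row // mulrN.
Qed.

Lemma minor_setC1 n (M : 'M[R]_n) (c : 'I_n) :
  cofactor M c c = minor M [set~ c].
Proof.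
rewrite cofactor_diag; apply: det_mxsub_minor; first exact: lift_inj.
move=> u; rewrite !inE; apply/codomP/idP => [[k ->]|].
  by rewrite eq_sym neq_lift.
by rewrite eq_sym => /unlift_some[k -> _]; exists k.
Qed.

(** The usual form of a bordered determinant: the row that replaces row [i] is
    expanded in turn. *)
Lemma det_border0 n (M : 'M[R]_n.+1) (N := row' ord0 (col' ord0 M)) :
  \det M = M ord0 ord0 * \det N
    - \sum_(i < n) \sum_(j < n)
        M (lift ord0 i) ord0 * M ord0 (lift ord0 j) * cofactor N i j.
Proof.
have NE : N = mxsub (lift ord0) (lift ord0) M.
  by apply/matrixP => a b; rewrite !mxE.
rewrite (det_border M ord0) cofactor_diag -NE; congr (_ - _).
rewrite big_mkcond big_ord_recl /= add0r; apply: eq_bigr => i _.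
rewrite cofactor_diag (expand_det_row _ i) mulr_sumr; apply: eq_bigr => j _.
rewrite !mxE eqxx mulrA; congr (_ * (_ * \det _)).
apply/matrixP => a b; rewrite !mxE (inj_eq lift_inj).
by rewrite eq_sym (negPf (neq_lift _ _)).
Qed.

(** In [det_border] only the vertices [u = e i (v i)] contribute.  Replacing the
    row of such a [u] by row [c] can only spoil the block structure in that row,
    so the matrix stays block triangular with respect to block [i] and its
    complement.  The complement contributes the determinants of the other
    blocks; in block [i] the new row is a multiple of a unit vector. *)
Lemma det_join (I : finType) (m : I -> nat) (v : forall i, 'I_(m i)) n
    (c : 'I_n) (e : forall i, 'I_(m i) -> 'I_n) (M : 'M[R]_n)
    (D := fun i => mxsub (e i) (e i) M) :
    (forall i, injective (e i)) ->
    (forall i j a b, e i a = e j b -> i = j) ->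
    (forall i a, e i a <> c) ->
    (forall u, u = c \/ exists i a, u = e i a) ->
    (forall i j a b, i <> j -> M (e i a) (e j b) = 0) ->
    (forall i a, a != v i -> M c (e i a) = 0 /\ M (e i a) c = 0) ->
  \det M = M c c * \prod_i \det (D i)
    - \sum_i M (e i (v i)) c * M c (e i (v i)) * cofactor (D i) (v i) (v i)
             * \prod_(k | k != i) \det (D k).
Proof.
move=> e_inj e_disj e_c e_cover M_across M_c.
pose A i := [set u | u \in codom (e i)].
have memA i a : e i a \in A i by rewrite inE codom_f.
have AP i u : u \in A i -> exists a, u = e i a by rewrite inE => /codomP.
have DA i M' : \det (mxsub (e i) (e i) M') = minor M' (A i).
  by apply: det_mxsub_minor => // u; rewrite inE.
have prodD (P : pred I) :
    \prod_(i | P i) \det (D i) = \prod_(i | P i) minor M (A i).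
  by apply: eq_bigr => i _; exact: DA.
have dA i j : i != j -> [disjoint A i & A j].
  move=> ij; apply/pred0P => u /=; apply/negP => /andP[/AP[a ->] /AP[b]].
  by move/e_disj/eqP; rewrite (negPf ij).
have MA i j a b : i != j -> a \in A i -> b \in A j -> M a b = 0.
  by move=> /eqP ij /AP[a' ->] /AP[b' ->]; exact: M_across.
have cE : [set~ c] = \bigcup_i A i.
  apply/setP => u; rewrite !inE; apply/idP/bigcupP => [|[i _ /AP[a ->]]].
    by case: (e_cover u) => [->|[i [a ->]] _]; [rewrite eqxx|exists i].
  exact/eqP.
rewrite (det_border M c) !minor_setC1 cE minor_bigcup //.
rewrite prodD.
congr (_ - _).
pose w i := e i (v i).
have w_inj : injective w by move=> i j; exact: e_disj.
rewrite (bigID (mem (w @: setT))) /= [X in _ + X]big1 ?addr0; last first.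
  move=> u /andP[uc]; case: (e_cover u) => [ec|[i [a ->]]].
    by rewrite ec eqxx in uc.
  move=> ia; rewrite (M_c _ _ _).2 ?mul0r //; apply: contraNneq ia => ->.
  exact: imset_f.
transitivity (\sum_(u in w @: setT)
    M u c * cofactor (replace_row M u c) c c).
  apply: eq_bigl => u; rewrite andbC; case: imsetP => //= -[i _ ->].
  exact/eqP/e_c.
rewrite big_imset => [|i j _ _]; last exact: w_inj.
rewrite (eq_bigl xpredT) => [|i]; last by rewrite inE.
apply: eq_bigr => i _ /=; rewrite minor_setC1 cE.
rewrite (bigD1 i) //=.
have sA k : k != i -> {in A k, forall a, a != w i}.
  by move=> ki a /AP[b ->]; apply: contraNneq ki => /e_disj ->.
rewrite minorU; last 2 first.
- by apply: bigcup_disjoint => k ki; apply: dA; rewrite eq_sym.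
- move=> a b /bigcupP[k ki ak] bi; rewrite mxE (negPf (sA _ ki _ ak)).
  exact: MA ki ak bi.
rewrite [minor _ (\bigcup_(k | _) _)](@eq_minor _ _ M); last first.
  move=> a b /bigcupP[k ki ak] _.
  by rewrite mxE (negPf (sA _ ki _ ak)).
rewrite minor_bigcup // -prodD -DA (expand_det_row _ (v i)) (bigD1 (v i)) //=.
rewrite big1 => [|a ai]; last by rewrite !mxE eqxx (M_c _ _ ai).1 mul0r.
rewrite addr0 !mxE eqxx !mulrA; congr (_ * _ * _).
congr (\det _); apply/matrixP => a b; rewrite !mxE.
by rewrite (inj_eq (@e_inj i)) eq_sym (negPf (neq_lift _ _)).
Qed.

End Determinants.

(** * Coxeter polynomials of a diagram with a distinguished vertex *)

(** The orientation of the Seifert matrix depends on the order of the vertices;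
    this makes deleting vertices compatible with it. *)
Lemma enum_val_ltn n (A : {set 'I_n}) (k l : 'I_#|A|) :
  (k < l)%N -> (enum_val k < enum_val l)%N.
Proof.
have A_sorted : sorted (relpre val ltn) (enum A).
  rewrite /enum_mem -enumT; apply: sorted_filter.
    by move=> a b c /=; exact: ltn_trans.
  by rewrite -sorted_map val_enum_ord iota_ltn_sorted.
move=> kl; have x0 := enum_val k; rewrite !(enum_val_nth x0).
apply: (sorted_ltn_nth _ _ A_sorted) => //; rewrite ?inE -?cardE //.
by move=> a b c /=; exact: ltn_trans.
Qed.

Section Diagrams.
Variable K : numFieldType.

Lemma coxmxE n (G : dynkin K n) (q : K) i j : coxmx G q i j =
  if i == j then q + q^-1 else - G i j * (if (i < j)%N then q else q^-1).
Proof.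
rewrite !mxE [j == i]eq_sym; case: eqVneq => [_|ij]; first by rewrite !mulr1.
have := ij; rewrite neq_ltn [G j i]weight_sym.
by case: ltngtP => // _ _; rewrite mulr0 ?addr0 ?add0r mulrC.
Qed.

Lemma coxmx_sub m n (T : dynkin K m) (G : dynkin K n) (f : 'I_m -> 'I_n)
    (q : K) : {homo f : a b / (a < b)%N} ->
  (forall a b, G (f a) (f b) = T a b) ->
  coxmx T q = mxsub f f (coxmx G q).
Proof.
move=> f_incr fG; apply/matrixP => a b; rewrite [RHS]mxE !coxmxE fG.
case: (ltngtP a b) => [ab|ba|/val_inj->]; last by rewrite !eqxx.
  by rewrite -!(inj_eq val_inj) !ltn_eqF ?f_incr.
have fba := f_incr _ _ ba.
by rewrite -!(inj_eq val_inj) /= (gtn_eqF ba) (gtn_eqF fba) ltnNge (ltnW fba).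
Qed.

Lemma coxpoly_delete n (G : dynkin K n) (I : {set 'I_n}) (q : K) :
  coxpoly (delete G I) q = minor (coxmx G q) (~: I).
Proof.
rewrite /coxpoly (coxmx_sub q (f := enum_val) (G := G)) //.
exact: enum_val_ltn.
Qed.

Lemma coxpoly_vertex n (G : dynkin K n.+1) (q : K) : q != 0 ->
  coxpoly G q = (q + q^-1) * coxpoly (delete G [set ord0]) q
    - \sum_(i < n) \sum_(j < n)
        G ord0 (lift ord0 i) * G ord0 (lift ord0 j) * coxcof G i j q.
Proof.
move=> q0; rewrite [LHS]det_border0 coxmxE eqxx coxpoly_delete -minor_setC1.
rewrite cofactor_diag; congr (_ * \det _ - _).
  by apply/matrixP => a b; rewrite !mxE.
apply: eq_bigr => i _; apply: eq_bigr => j _; rewrite !coxmxE /=.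
by rewrite [X in X * _]mulrACA mulVf // mulr1 mulrNN [G (lift _ _) _]weight_sym.
Qed.

(** The diagonal terms of [coxpoly_vertex] come from deleting a second vertex. *)
Lemma coxcof_diag n (G : dynkin K n.+1) (i : 'I_n) (q : K) :
  coxcof G i i q = coxpoly (delete G [set ord0; lift ord0 i]) q.
Proof.
rewrite coxpoly_delete /coxcof cofactor_diag.
have -> : row' ord0 (col' ord0 (coxmx G q)) =
          mxsub (lift ord0) (lift ord0) (coxmx G q).
  by apply/matrixP => a b; rewrite !mxE.
rewrite -mxsub_comp; apply: det_mxsub_minor.
  by apply: inj_comp; exact: lift_inj.
move=> u; rewrite !inE negb_or; apply/codomP/andP => [[k ->]|[]].
  by rewrite /= (inj_eq lift_inj) ![lift _ _ == _]eq_sym !neq_lift.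
rewrite eq_sym => /unlift_some[k -> _]; rewrite (inj_eq lift_inj) eq_sym.
by move=> /unlift_some[l -> _]; exists l.
Qed.

(** The two entries joining [c] to a marked vertex are [- q] and [- q^-1] in an
    order that depends on the position of [c], but their product is 1. *)
Lemma coxpoly_join (I : finType) (m : I -> nat) (T : forall i, dynkin K (m i))
    (v : forall i, 'I_(m i)) n (G : dynkin K n) (q : K) :
    q != 0 -> is_join T v G ->
  coxpoly G q = (q + q^-1) * \prod_i coxpoly (T i) q
    - \sum_i coxpoly (delete (T i) [set v i]) q
             * \prod_(k | k != i) coxpoly (T k) q.
Proof.
move=> q0 [c [e [[e_incr e_disj e_c e_cover] [GT Gacross Gc]]]].
have e_inj i : injective (e i).
  move=> a b eab.
  by case: (ltngtP a b) => [/e_incr|/e_incr|/val_inj//]; rewrite eab ltnn.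
have TE i : coxpoly (T i) q = \det (mxsub (e i) (e i) (coxmx G q)).
  by rewrite /coxpoly (coxmx_sub q (@e_incr i) (GT i)).
have cP i a : c == e i a = false by apply/eqP => /esym; exact: e_c.
have prodE (P : pred I) : \prod_(i | P i) coxpoly (T i) q =
    \prod_(i | P i) \det (mxsub (e i) (e i) (coxmx G q)).
  by apply: eq_bigr => i _; exact: TE.
rewrite [LHS](@det_join _ I m v n c e) //.
- rewrite coxmxE eqxx prodE; congr (_ - _); apply: eq_bigr => i _.
  rewrite prodE; congr (_ * _).
  rewrite -(coxmx_sub q (@e_incr i) (GT i)) minor_setC1 coxpoly_delete.
  rewrite !coxmxE [e i _ == c]eq_sym cP [G (e i _) c]weight_sym Gc eqxx.
  have := cP i (v i); rewrite -(inj_eq val_inj) /=.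
  by case: ltngtP => // _ _; rewrite mulrACA mulrNN !mulr1 ?mulVf ?mulfV ?mul1r.
- move=> i j a b ij; rewrite coxmxE Gacross // oppr0 mul0r ifF //.
  by apply/eqP => /e_disj.
- move=> i a av; rewrite !coxmxE [e i _ == c]eq_sym cP [G (e i _) c]weight_sym.
  by rewrite Gc (negPf av) oppr0 !mul0r.
Qed.

End Diagrams.

(** * Bezoutians, Wronskians and the recurrence *)

From mathcomp Require Import boolp classical_sets topology normedtype derive.
From mathcomp Require Import ring.
Import numFieldNormedType.Exports.

Section Bezoutian.
Variable K : numFieldType.
Implicit Types f g h u v w : K -> K.

Lemma cvg_Bez_Wr f g (x : K) : derivable f x 1 -> derivable g x 1 ->
  (Bez f g x y @[y --> x^'] --> Wr f g x)%classic.
Proof. by move=> df dg; rewrite WrE //; exact: cvg_Bez. Qed.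

Lemma cvg_dnbhs_derivable f (x : K) : derivable f x 1 ->
  (f y @[y --> x^'] --> f x)%classic.
Proof.
move=> /derivable1_diffP/differentiable_continuous.
by move=> /continuous_withinNx.
Qed.

(** Every identity between Wronskians below is obtained as the limit of the
    corresponding identity between Bezoutians, known for nearby [y]. *)
Lemma Wr_unique f g (B : K -> K) (x b : K) :
    derivable f x 1 -> derivable g x 1 -> x != 0 ->
    (forall y, y != 0 -> x != y -> Bez f g x y = B y) ->
    (B y @[y --> x^'] --> b)%classic ->
  Wr f g x = b.
Proof.
move=> df dg x0 BE Bb; apply: cvg_lim => //.
apply: cvg_trans Bb; apply: near_eq_cvg; near=> y.
rewrite BE //; last by rewrite eq_sym; near: y; exact: nbhs_dnbhs_neq.
near: y; apply: (cvgr_neq0 x) => //; exact: nbhs_dnbhs.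
Unshelve. all: by end_near. Qed.

Lemma Bez_mulr u v w (x y : K) :
  Bez (fun q => u q * w q) (fun q => v q * w q) x y = Bez u v x y * (w x * w y).
Proof. rewrite /Bez [RHS]mulrAC; congr (_ / _); ring. Qed.

Lemma Wr_mulr u v w (x : K) :
    derivable u x 1 -> derivable v x 1 -> derivable w x 1 -> x != 0 ->
  Wr (fun q => u q * w q) (fun q => v q * w q) x = Wr u v x * w x ^+ 2.
Proof.
move=> du dv dw x0.
apply: (Wr_unique (B := fun y => Bez u v x y * (w x * w y))) => //.
- exact: (derivableM du dw).
- exact: (derivableM dv dw).
- by move=> y _ _; exact: Bez_mulr.
- apply: cvgM; first exact: cvg_Bez_Wr.
  by rewrite expr2; apply: cvgM; [exact: cvg_cst|exact: cvg_dnbhs_derivable].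
Qed.

Lemma Bez_scaler (c : K) g h (x y : K) :
  Bez g (fun q => c * h q) x y = c * Bez g h x y.
Proof. rewrite /Bez [RHS]mulrA; congr (_ / _); ring. Qed.

Lemma Wr_scaler (c : K) g h (x : K) :
    derivable g x 1 -> derivable h x 1 -> x != 0 ->
  Wr g (fun q => c * h q) x = c * Wr g h x.
Proof.
move=> dg dh x0; apply: (Wr_unique (B := fun y => c * Bez g h x y)) => //.
- by apply: derivableM dh; exact: derivable_cst.
- by move=> y _ _; exact: Bez_scaler.
- by apply: cvgM; [exact: cvg_cst|exact: cvg_Bez_Wr].
Qed.

(** In the applications [f] is the Coxeter polynomial of a diagram, [g] that of
    the diagram without one vertex, and the [h j] are the terms of the
    expansion at that vertex. *)
Section Recurrence.
Variables (J : finType) (f g : K -> K) (h : J -> K -> K).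
Hypothesis fE : forall q, q != 0 -> f q = (q + q^-1) * g q - \sum_j h j q.

Lemma Bez_recurrence (x y : K) : x != 0 -> y != 0 -> x != y ->
  Bez f g x y = (1 - (x * y)^-1) * (g x * g y) + \sum_j Bez g (h j) x y.
Proof.
move=> x0 y0 xy; rewrite {1}/Bez !fE //.
have -> : \sum_j Bez g (h j) x y =
    (g x * (\sum_j h j y) - g y * (\sum_j h j x)) / (x - y).
  by rewrite !mulr_sumr -sumrB mulr_suml.
by field; rewrite subr_eq0 xy x0 y0.
Qed.

Lemma Wr_recurrence (x : K) : x != 0 -> derivable f x 1 ->
    derivable g x 1 -> (forall j, derivable (h j) x 1) ->
  Wr f g x = (1 - x ^- 2) * g x ^+ 2 + \sum_j Wr g (h j) x.
Proof.
move=> x0 df dg dh; apply: (Wr_unique df dg x0).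
  by move=> y y0 xy; exact: Bez_recurrence.
apply: cvgD; last first.
  by apply: (cvg_big add_continuous) => j _; exact: cvg_Bez_Wr.
rewrite !expr2; apply: cvgM; apply: cvgM || apply: cvgB; try exact: cvg_cst.
  apply: cvgV; first by rewrite mulf_neq0.
  by apply: cvgM; [exact: cvg_cst|exact: nbhs_dnbhs].
exact: cvg_dnbhs_derivable.
Qed.

End Recurrence.
End Bezoutian.

Theorem mainTheorem1 (K : numFieldType) :
  (forall (n : nat) (G : dynkin K n.+1),
     let P := coxpoly G in
     let P1 := coxpoly (delete G [set ord0]) in
     let P1i := fun i : 'I_n => coxpoly (delete G [set ord0; lift ord0 i]) in
     let a1 := fun i : 'I_n => G ord0 (lift ord0 i) in
     (forall x y : K, x != 0 -> y != 0 -> x != y ->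
        Bez P P1 x y =
          (1 - (x * y)^-1) * (P1 x * P1 y)
          + \sum_(i < n) a1 i ^+ 2 * Bez P1 (P1i i) x y
          + \sum_(i < n) \sum_(j < n | j != i)
              a1 i * a1 j * Bez P1 (coxcof G i j) x y) /\
     (forall x : K, x != 0 ->
        Wr P P1 x =
          (1 - x ^- 2) * P1 x ^+ 2
          + \sum_(i < n) a1 i ^+ 2 * Wr P1 (P1i i) x
          + \sum_(i < n) \sum_(j < n | j != i)
              a1 i * a1 j * Wr P1 (coxcof G i j) x))
  /\
  (forall (I : finType) (m : I -> nat) (T : forall i, dynkin K (m i))
          (v : forall i, 'I_(m i)) (n : nat) (G : dynkin K n),
     is_join T v G ->
     let prodT := fun q : K => \prod_(i : I) coxpoly (T i) q in
     let Tbar := fun j : I => coxpoly (delete (T j) [set v j]) in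
     (forall x y : K, x != 0 -> y != 0 -> x != y ->
        Bez (coxpoly G) prodT x y =
          (1 - (x * y)^-1) * \prod_(i : I) (coxpoly (T i) x * coxpoly (T i) y)
          + \sum_(j : I) Bez (coxpoly (T j)) (Tbar j) x y
              * \prod_(i : I | i != j) (coxpoly (T i) x * coxpoly (T i) y)) /\
     (forall x : K, x != 0 ->
        Wr (coxpoly G) prodT x =
          (1 - x ^- 2) * \prod_(i : I) coxpoly (T i) x ^+ 2
          + \sum_(j : I) Wr (coxpoly (T j)) (Tbar j) x
              * \prod_(i : I | i != j) coxpoly (T i) x ^+ 2)).
Proof.
split=> [n G P P1 P1i a1|I m T v n G joinG prodT Tbar].
  pose h (p : 'I_n * 'I_n) (q : K) := a1 p.1 * a1 p.2 * coxcof G p.1 p.2 q.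
  have PE q : q != 0 -> P q = (q + q^-1) * P1 q - \sum_p h p q.
    by move=> q0; rewrite /P coxpoly_vertex // pair_bigA.
  have P1iE i : coxcof G i i = P1i i by apply/funext => q; exact: coxcof_diag.
  (* For B a Bezoutian or a Wronskian against P1: the diagonal terms are the
     P1i, by P1iE. *)
  have sumE (B : (K -> K) -> K) :
      \sum_(p : 'I_n * 'I_n) a1 p.1 * a1 p.2 * B (coxcof G p.1 p.2) =
      \sum_i a1 i ^+ 2 * B (P1i i)
      + \sum_i \sum_(j | j != i) a1 i * a1 j * B (coxcof G i j).
    rewrite -big_split.
    rewrite -(pair_bigA _ (fun i j => a1 i * a1 j * B (coxcof G i j))).
    by apply: eq_bigr => i _; rewrite (bigD1 i) //= P1iE expr2.
  split=> [x y x0 y0 xy|x x0].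
    rewrite (Bez_recurrence PE) // -addrA -(sumE (fun f => Bez P1 f x y)).
    by congr (_ + _); apply: eq_bigr => p _; rewrite Bez_scaler.
  have dP1 : derivable P1 x 1 by exact: derivable_coxpoly.
  have dcof i j : derivable (coxcof G i j) x 1 by exact: derivable_coxcof.
  rewrite (Wr_recurrence PE) //.
  - rewrite -addrA -(sumE (fun f => Wr P1 f x)).
    by congr (_ + _); apply: eq_bigr => p _; rewrite Wr_scaler.
  - exact: derivable_coxpoly.
  - by move=> p; apply: derivableM (dcof _ _); exact: derivable_cst.
pose rest i (q : K) := \prod_(k | k != i) coxpoly (T k) q.
pose h i (q : K) := Tbar i q * rest i q.
have GE q : q != 0 -> coxpoly G q = (q + q^-1) * prodT q - \sum_i h i q.
  by move=> q0; exact: coxpoly_join.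
have prodTE i : prodT = fun q => coxpoly (T i) q * rest i q.
  by apply/funext => q; rewrite /prodT (bigD1 i).
split=> [x y x0 y0 xy|x x0].
  rewrite (Bez_recurrence GE) // big_split; congr (_ + _).
  apply: eq_bigr => i _; rewrite (prodTE i) Bez_mulr.
  by rewrite big_split.
have dT i : derivable (coxpoly (T i)) x 1 by exact: derivable_coxpoly.
have dTbar i : derivable (Tbar i) x 1 by exact: derivable_coxpoly.
have drest i : derivable (rest i) x 1 by exact: derivable_bigprod.
rewrite (Wr_recurrence GE) //.
- rewrite prodrXl; congr (_ + _); apply: eq_bigr => i _.
  by rewrite (prodTE i) Wr_mulr // prodrXl.
- exact: derivable_coxpoly.
- exact: derivable_bigprod.
- by move=> i; exact: (derivableM (dTbar i) (drest i)).
Qed.
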